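(* Let $\mathcal{C}$ be a bounded below graded poset and let $F:\mathcal{C}\rightarrow \mathrm{Ab}$ be a pseudo-projective functor. Then $F$ is $\mathrm{colim}$-acyclic, that is, $\mathrm{colim}_i F=0$ for all $i\ge 1$, where $\mathrm{colim}_i$ denotes the $i$-th left derived functor of $\mathrm{colim}:\mathrm{Ab}^{\mathcal{C}}\to\mathrm{Ab}$.
   Context: $\mathrm{Ab}$ is the category of abelian groups and $\mathrm{Ab}^{\mathcal{C}}$ is the abelian category of (covariant) functors $\mathcal{C}\to\mathrm{Ab}$ and natural transformations, for $\mathcal{C}$ small. A poset $\mathcal{P}$ is regarded as a category with exactly one arrow $p\to p'$ if $p\le p'$ and none otherwise. Graded poset: for $p<p'$ in $\mathcal{P}$, $p$ precedes $p'$ if $p\le p''\le p'$ implies $p''=p$ or $p''=p'$. $\mathcal{P}$ is graded if there is a function $\deg:\mathrm{Ob}(\mathcal{P})\to\mathbb{Z}$ (an increasing degree function) which is strictly order preserving ($p<p'$ implies $\deg(p)<\deg(p')$) and such that $\deg(p')=\deg(p)+1$ whenever $p$ precedes $p'$. For an arrow $p\to p'$ set $\deg(p\to p')=|\deg(p')-\deg(p)|$; this does not depend on the choice of degree function. $\mathcal{P}$ is bounded below if $\deg(\mathrm{Ob}(\mathcal{P}))\subset\mathbb{Z}$ has a lower bound, for an increasing degree function $\deg$. For a functor $F:\mathcal{P}\to\mathrm{Ab}$ and an object $i_0$, let $\mathrm{Im}_F(i_0)=\sum_{\alpha:i\to i_0,\ \alpha\ne 1_{i_0}}\mathrm{Im}\,F(\alpha)\subseteq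 F(i_0)$ (equal to $0$ if there is no such $\alpha$). For $d\ge 0$, $F$ is $d$-pseudo-projective if for any object $i_0$, any $k$ different objects $i_1,\dots,i_k$, arrows $\alpha_j:i_j\to i_0$ with $\deg(\alpha_j)=d$ and elements $x_j\in F(i_j)$ ($j=1,\dots,k$) such that $\sum_{j=1}^k F(\alpha_j)(x_j)=0$, one has $x_j\in\mathrm{Im}_F(i_j)$ for all $j=1,\dots,k$. (For $d=0$ this always holds.) $F$ is pseudo-projective if it is $d$-pseudo-projective for every $d\ge0$. *)

(* Defs.v *)
(* Abelian groups are [zmodType]s; in the presence of the
   classical axioms of [boolp] this is no restriction. *)
From HB Require Import structures.
From mathcomp Require Import all_boot all_order all_algebra.
From mathcomp Require Import generic_quotient ring_quotient zify.
From mathcomp Require Import boolp freeg.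

Set Implicit Arguments.
Unset Strict Implicit.
Unset Printing Implicit Defensive.

Import Order.TTheory GRing.Theory Num.Theory.
Local Open Scope ring_scope.
Local Open Scope quotient_scope.

(** * Graded posets *)

Section GradedPoset.
Context {disp : Order.disp_t} {C : porderType disp}.
Implicit Types (p q : C) (deg : C -> int).

Definition precedes p q : Prop :=
  (p < q)%O /\ forall r : C, (p <= r)%O -> (r <= q)%O -> r = p \/ r = q.

Definition increasing_degree deg : Prop :=
  (forall p q, (p < q)%O -> deg p < deg q) /\
  (forall p q, precedes p q -> deg q = deg p + 1).

Definition deg_bounded_below deg : Prop := exists m : int, forall p, m <= deg p.

Definition arrow_deg deg p q : nat := `|deg q - deg p|%N.

Lemma arrow_deg_indep deg deg' p q :
  increasing_degree deg -> increasing_degree deg' -> (p <= q)%O ->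
  arrow_deg deg p q = arrow_deg deg' p q.
Proof.
move=> [degS degP] [degS' degP'] pq; rewrite /arrow_deg; congr absz.
have [n] := ubnP `|deg q - deg p|%N.
elim: n p q pq => // n IH p q pq nP.
case: (pselect (p = q)) => [->|/eqP npq]; first by rewrite !subrr.
have ltpq : (p < q)%O by rewrite lt_neqAle npq.
case: (pselect (precedes p q)) => [pr|npr].
  by rewrite (degP _ _ pr) (degP' _ _ pr) ![_ + 1]addrC !addrK.
have [r [pr rq]] : exists r, (p < r)%O /\ (r < q)%O.
  apply: contrapT => nex; apply: npr; split=> // r pr rq.
  case: (pselect (r = p)) => [|/eqP rp]; first by left.
  case: (pselect (r = q)) => [|/eqP rq']; first by right.
  by case: nex; exists r; rewrite !lt_neqAle eq_sym rp pr rq' rq.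
have dpr := degS _ _ pr; have drq := degS _ _ rq.
have e1 : deg q - deg r = deg' q - deg' r by apply: IH; [exact: ltW | lia].
have e2 : deg r - deg p = deg' r - deg' p by apply: IH; [exact: ltW | lia].
by lia.
Qed.

End GradedPoset.

(** * Constructions on abelian groups *)

Section Kernel.
Variables (A B : zmodType) (f : {additive A -> B}).

Definition ker_pred : {pred A} := [pred x | f x == 0].

Fact ker_pred_closed : zmod_closed ker_pred.
Proof.
split=> [|x y]; rewrite !inE ?raddf0 // => /eqP fx /eqP fy.
by rewrite raddfB fx fy subrr.
Qed.
HB.instance Definition _ := GRing.isZmodClosed.Build A ker_pred ker_pred_closed.

Record ker := Ker { ker_val :> A; ker_valP : ker_val \in ker_pred }.
HB.instance Definition _ := [isSub for ker_val].
HB.instance Definition _ := [Choice of ker by <:].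
HB.instance Definition _ := [SubChoice_isSubZmodule of ker by <:].

Lemma ker_val_additive : zmod_morphism ker_val.
Proof. exact: raddfB (\val : ker -> A). Qed.
HB.instance Definition _ :=
  GRing.isZmodMorphism.Build ker A ker_val ker_val_additive.

Lemma kerP (x : ker) : f (ker_val x) = 0.
Proof. by apply/eqP; exact: ker_valP. Qed.

End Kernel.

(* The homology of A --f--> B --g--> D at B, as ker g / (im f ∩ ker g); here
   im f ∩ ker g = im f as soon as g \o f = 0. *)
Section Homology.
Variables (A B D : zmodType) (f : {additive A -> B}) (g : {additive B -> D}).

Definition boundary : {pred ker g} :=
  fun z => `[< exists a : A, f a = ker_val z >].

Fact boundary_closed : zmod_closed boundary.
Proof.
split=> [|x y]; rewrite !unfold_in.
  by apply/asboolP; exists 0; rewrite !raddf0.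
move=> /asboolP[a ax] /asboolP[b bx]; apply/asboolP; exists (a - b).
by rewrite !raddfB ax bx.
Qed.
HB.instance Definition _ :=
  GRing.isZmodClosed.Build (ker g) boundary boundary_closed.

Definition homology : zmodType := Quotient.quot boundary.

End Homology.

Inductive generated (A : zmodType) (S : A -> Prop) : A -> Prop :=
| generated0 : generated S 0
| generatedB x y : generated S x -> generated S y -> generated S (x - y)
| generated_in x : S x -> generated S x.

Section QuotientByRelations.
Variables (A : zmodType) (S : A -> Prop).

Definition gen_pred : {pred A} := fun x => `[< generated S x >].

Fact gen_pred_closed : zmod_closed gen_pred.
Proof.
split=> [|x y]; rewrite !unfold_in.
  by apply/asboolP; exact: generated0.
by move=> /asboolP gx /asboolP gy; apply/asboolP; exact: generatedB.
Qed.
HB.instance Definition _ := GRing.isZmodClosed.Build A gen_pred gen_pred_closed.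

Definition quot_by : zmodType := Quotient.quot gen_pred.
Definition quot_pi : A -> quot_by := \pi_(Quotient.quot gen_pred).

Lemma quot_pi_additive : zmod_morphism quot_pi.
Proof. exact: raddfB. Qed.
HB.instance Definition _ :=
  GRing.isZmodMorphism.Build A quot_by quot_pi quot_pi_additive.

Lemma quot_pi_surj (z : quot_by) : exists x, quot_pi x = z.
Proof. by exists (repr z); rewrite /quot_pi reprK. Qed.

Lemma quot_pi_eq (x y : A) : quot_pi x = quot_pi y <-> generated S (x - y).
Proof.
split=> [/eqP|h]; first by rewrite -Quotient.idealrBE => /asboolP.
by apply/eqP; rewrite -Quotient.idealrBE; apply/asboolP.
Qed.

End QuotientByRelations.

Section QuotientLift.
Variables (A B : zmodType) (S : A -> Prop) (f : {additive A -> B}).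

Definition quot_lift (_ : forall x, S x -> f x = 0) (z : quot_by S) : B :=
  f (repr (z : Quotient.quot (gen_pred S))).

Hypothesis fS : forall x, S x -> f x = 0.

Lemma quot_liftE x : quot_lift fS (quot_pi S x) = f x.
Proof.
have fgen y : generated S y -> f y = 0.
  elim=> [|u v _ u0 _ v0|u /fS //]; first exact: raddf0.
  by rewrite raddfB u0 v0 subrr.
apply/eqP; rewrite -subr_eq0 -raddfB; apply/eqP/fgen/quot_pi_eq.
exact: reprK.
Qed.

Lemma quot_lift_additive : zmod_morphism (quot_lift fS).
Proof.
move=> u v; have [x <-] := quot_pi_surj u; have [y <-] := quot_pi_surj v.
by rewrite -raddfB !quot_liftE raddfB.
Qed.
HB.instance Definition _ :=
  GRing.isZmodMorphism.Build (quot_by S) B (quot_lift fS) quot_lift_additive.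

End QuotientLift.

Section FreeAbelianExtension.
Variables (K : choiceType) (A : zmodType) (f : K -> A).

Definition free_ext : {freeg K} -> A := fglift (f : K -> zmodule A).

Lemma free_ext_additive : zmod_morphism free_ext.
Proof. exact: (@lift_is_additive int K (zmodule A)). Qed.
HB.instance Definition _ :=
  GRing.isZmodMorphism.Build {freeg K} A free_ext free_ext_additive.

Lemma free_extE k : free_ext << k >> = f k.
Proof. by rewrite /free_ext liftU scale1r. Qed.

End FreeAbelianExtension.

Lemma free_additive_eq (K : choiceType) (A : zmodType)
    (f g : {additive {freeg K} -> A}) :
  (forall k, f << k >> = g << k >>) -> forall x, f x = g x.
Proof.
move=> fg; elim/freeg_ind_dom0 => [|c k D _ _ IH]; first by rewrite !raddf0.
rewrite !raddfD IH; congr (_ + _).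
have -> : << c *g k >> = << k >> *~ c :> {freeg K} by rewrite freegU_mulz intz.
by rewrite !raddfMz fg.
Qed.

(** * Functors from a poset to abelian groups *)

(* [i <= j] is a boolean statement, hence has at most one proof: there is at
   most one arrow i -> j. *)
Record functor (disp : Order.disp_t) (C : porderType disp) := Functor {
  fob :> C -> zmodType;
  fmap : forall i j : C, (i <= j)%O -> {additive fob i -> fob j};
  fmap_id : forall (i : C) (h : (i <= i)%O) x, fmap h x = x;
  fmap_comp : forall (i j k : C) (ij : (i <= j)%O) (jk : (j <= k)%O)
    (ik : (i <= k)%O) x, fmap jk (fmap ij x) = fmap ik x
}.
Arguments fmap {disp C} f {i j}.

Record nat_trans (disp : Order.disp_t) (C : porderType disp)
    (F G : functor C) := NatTrans {
  ntc :> forall i : C, {additive F i -> G i};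
  ntc_nat : forall (i j : C) (h : (i <= j)%O) x,
    ntc j (fmap F h x) = fmap G h (ntc i x)
}.

Section PseudoProjective.
Context {disp : Order.disp_t} {C : porderType disp}.
Implicit Types (F : functor C) (deg : C -> int).

(* Membership in Im_F(i0), the sum of the images of all arrows a k -> i0
   different from the identity, that is with a k < i0. *)
Definition in_Im F (i0 : C) (x : F i0) : Prop :=
  exists (n : nat) (a : 'I_n -> C) (h : forall k, (a k < i0)%O)
    (y : forall k, F (a k)), x = \sum_(k < n) fmap F (ltW (h k)) (y k).

Definition d_pseudo_projective deg (d : nat) F : Prop :=
  forall (i0 : C) (k : nat) (a : 'I_k -> C) (h : forall j, (a j <= i0)%O)
    (x : forall j, F (a j)),
    injective a -> (forall j, arrow_deg deg (a j) i0 = d) ->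
    \sum_(j < k) fmap F (h j) (x j) = 0 ->
    forall j, in_Im (x j).

Definition pseudo_projective deg F : Prop :=
  forall d, d_pseudo_projective deg d F.

End PseudoProjective.

(** * Projective resolutions *)

Section Projective.
Context {disp : Order.disp_t} {C : porderType disp}.
Implicit Types F G H : functor C.

Definition epi F G (e : nat_trans F G) : Prop :=
  forall H (a b : nat_trans G H),
    (forall i x, a i (e i x) = b i (e i x)) -> forall i y, a i y = b i y.

Definition projective F : Prop :=
  forall G H (e : nat_trans G H), epi e ->
  forall g : nat_trans F H, exists l : nat_trans F G,
    forall i x, e i (l i x) = g i x.

(* Kernels and images of natural transformations are computed objectwise. *)
Definition exact F G H (f : nat_trans F G) (g : nat_trans G H) : Prop :=
  forall i y, g i y = 0 <-> exists x, f i x = y.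

(* ... -> P 1 -> P 0 -> F -> 0 *)
Record proj_resolution F := ProjResolution {
  res :> nat -> functor C;
  res_d : forall n, nat_trans (res n.+1) (res n);
  res_aug : nat_trans (res 0%N) F;
  res_projective : forall n, projective (res n);
  res_aug_epi : epi res_aug;
  res_exact0 : exact (res_d 0%N) res_aug;
  res_exact : forall n, exact (res_d n.+1) (res_d n)
}.

End Projective.

(** * The colimit and its left derived functors *)

Section Colimit.
Context {disp : Order.disp_t} {C : porderType disp}.

(* The colimit is the direct sum of the F i modulo x ~ F(i -> j)(x); both
   steps are performed at once, as a quotient of the free abelian group on the
   disjoint union of the F i. *)
Definition colim_gen (F : functor C) (i : C) (x : F i) :
    {freeg {i : C & F i}} := << Tagged (fob F) x >>.

Inductive colim_rel (F : functor C) : {freeg {i : C & F i}} -> Prop :=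
| colim_rel_add i (x y : F i) :
    colim_rel (colim_gen (x + y) - (colim_gen x + colim_gen y))
| colim_rel_map i j (h : (i <= j)%O) (x : F i) :
    colim_rel (colim_gen (fmap F h x) - colim_gen x).

Definition colim (F : functor C) : zmodType := quot_by (@colim_rel F).

Section Cocone.
Variables (F : functor C) (i : C).

Definition colim_in (x : F i) : colim F :=
  quot_pi (@colim_rel F) (colim_gen x).

Lemma colim_in_additive : zmod_morphism colim_in.
Proof.
have inD (x y : F i) : colim_in (x + y) = colim_in x + colim_in y.
  rewrite /colim_in -raddfD; apply/quot_pi_eq/generated_in.
  exact: colim_rel_add.
by move=> x y; apply: (addIr (colim_in y)); rewrite -inD !subrK.
Qed.
HB.instance Definition _ :=
  GRing.isZmodMorphism.Build (F i) (colim F) colim_in colim_in_additive.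

End Cocone.

Lemma colim_in_nat (F : functor C) i j (h : (i <= j)%O) (x : F i) :
  colim_in (fmap F h x) = colim_in x.
Proof. by apply/quot_pi_eq/generated_in; exact: colim_rel_map. Qed.

Lemma colim_additive_eq (F : functor C) (A : zmodType)
    (f g : {additive colim F -> A}) :
  (forall i (x : F i), f (colim_in x) = g (colim_in x)) ->
  forall z, f z = g z.
Proof.
move=> fg z; have [x <-] := quot_pi_surj z.
apply: (@free_additive_eq _ _ (f \o quot_pi _) (g \o quot_pi _)).
by case=> i y; exact: fg.
Qed.

Section UniversalProperty.
Variables (F : functor C) (A : zmodType) (c : forall i, {additive F i -> A}).
Hypothesis c_nat : forall i j (h : (i <= j)%O) x, c j (fmap F h x) = c i x.

Let lift : {additive {freeg {i : C & F i}} -> A} :=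
  free_ext (fun u : {i : C & F i} => c (tag u) (tagged u)).

Let lift_gen i (x : F i) : lift (colim_gen x) = c i x.
Proof. exact: free_extE. Qed.

Fact colim_desc_rel x : colim_rel x -> lift x = 0.
Proof.
case=> [i y z|i j h y]; first by rewrite raddfB raddfD !lift_gen raddfD subrr.
by rewrite raddfB !lift_gen c_nat subrr.
Qed.

Definition colim_desc : {additive colim F -> A} := quot_lift colim_desc_rel.

Lemma colim_descE i (x : F i) : colim_desc (colim_in x) = c i x.
Proof. by rewrite [LHS]quot_liftE lift_gen. Qed.

End UniversalProperty.

Fact colim_map_nat (F G : functor C) (t : nat_trans F G) :
  forall i j (h : (i <= j)%O) x,
    (@colim_in G j \o t j) (fmap F h x) = (@colim_in G i \o t i) x.
Proof. by move=> i j h x; rewrite /= ntc_nat colim_in_nat. Qed.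

Definition colim_map (F G : functor C) (t : nat_trans F G) :
    {additive colim F -> colim G} := colim_desc (colim_map_nat t).

Lemma colim_mapE (F G : functor C) (t : nat_trans F G) i (x : F i) :
  colim_map t (colim_in x) = colim_in (t i x).
Proof. exact: (colim_descE (colim_map_nat t)). Qed.

(* colim_n F computed on the projective resolution P of F, namely the n-th
   homology of ... -> colim (P 1) -> colim (P 0) -> 0. *)
Definition Lcolim (F : functor C) (P : proj_resolution F) (n : nat) : zmodType :=
  if n is m.+1 then homology (colim_map (res_d P m.+1)) (colim_map (res_d P m))
  else homology (colim_map (res_d P 0%N)) (\0 : {additive colim (P 0%N) -> 'I_1}).

(* The groups Lcolim P n for different P are isomorphic, and a resolution P
   exists (see [proj_resolution_exists] below). *)
Definition colim_acyclic (F : functor C) : Prop :=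
  forall (P : proj_resolution F) (n : nat), (1 <= n)%N ->
  forall x : Lcolim P n, x = 0.

End Colimit.

(** * Existence of projective resolutions *)

Section Existence.
Context {disp : Order.disp_t} {C : porderType disp}.
Implicit Types F G H : functor C.

Section Cokernel.
Variables (F G : functor C) (e : nat_trans F G).

Let im i (y : G i) : Prop := exists x, e i x = y.

Let proj i : {additive G i -> quot_by (@im i)} := quot_pi (@im i).

Let coker_map_rel i j (h : (i <= j)%O) (y : G i) :
  im y -> (proj j \o fmap G h) y = 0.
Proof.
move=> [x <-]; rewrite /= -ntc_nat -(raddf0 (proj j)).
by apply/quot_pi_eq/generated_in; rewrite subr0; exists (fmap F h x).
Qed.

Let coker_map i j (h : (i <= j)%O) :
    {additive quot_by (@im i) -> quot_by (@im j)} :=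
  quot_lift (@coker_map_rel i j h).

Let coker_mapE i j (h : (i <= j)%O) (y : G i) :
  coker_map h (proj i y) = proj j (fmap G h y).
Proof. exact: quot_liftE. Qed.

Let coker : functor C.
Proof.
apply: (@Functor _ C (fun i => quot_by (@im i)) coker_map).
  move=> i h z; have [x <-] := quot_pi_surj z.
  by rewrite [LHS](coker_mapE h) fmap_id.
move=> i j k ij jk ik z; have [x <-] := quot_pi_surj z.
rewrite [X in coker_map jk X](coker_mapE ij) [LHS]coker_mapE.
by rewrite [RHS]coker_mapE (fmap_comp ij jk ik).
Defined.

Let to_coker : nat_trans G coker.
Proof.
by apply: (@NatTrans _ _ G coker proj) => i j h x; rewrite [RHS]coker_mapE.
Defined.

Let zero_coker : nat_trans G coker.
Proof.
apply: (@NatTrans _ _ G coker (fun i => \0)) => i j h x.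
by rewrite [RHS]raddf0.
Defined.

Lemma epi_surj : epi e -> forall i y, exists x, e i x = y.
Proof.
move=> ee i y.
have /(ee _ to_coker zero_coker) /(_ i y) /= py :
    forall i x, to_coker i (e i x) = zero_coker i (e i x).
  move=> j x /=; rewrite -[RHS](raddf0 (proj j)).
  by apply/quot_pi_eq/generated_in; rewrite subr0; exists x.
have : generated (@im i) (y - 0).
  by apply/quot_pi_eq; rewrite [LHS]py; apply/esym/raddf0.
rewrite subr0; elim=> [|u v _ [a <-] _ [b <-]|//].
  by exists 0; rewrite raddf0.
by exists (a - b); rewrite raddfB.
Qed.

Lemma surj_epi : (forall i y, exists x, e i x = y) -> epi e.
Proof. by move=> es H a b ab i y; have [x <-] := es i y. Qed.

End Cokernel.

Section KernelFunctor.
Variables (F G : functor C) (e : nat_trans F G).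

Fact ker_map_subproof i j (h : (i <= j)%O) (x : ker (e i)) :
  fmap F h (ker_val x) \in ker_pred (e j).
Proof. by rewrite inE ntc_nat kerP raddf0. Qed.

Definition ker_map i j (h : (i <= j)%O) (x : ker (e i)) : ker (e j) :=
  Ker (ker_map_subproof h x).

Fact ker_map_additive i j (h : (i <= j)%O) : zmod_morphism (@ker_map i j h).
Proof. by move=> x y; apply: val_inj; rewrite /= [LHS]raddfB. Qed.
HB.instance Definition _ i j (h : (i <= j)%O) :=
  GRing.isZmodMorphism.Build (ker (e i)) (ker (e j)) (@ker_map i j h)
    (@ker_map_additive i j h).

Definition ker_functor : functor C.
Proof.
apply: (@Functor _ C (fun i => ker (e i)) (fun i j h => @ker_map i j h)).
  by move=> i h x; apply: val_inj; exact: fmap_id.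
by move=> i j k ij jk ik x; apply: val_inj; exact: fmap_comp.
Defined.

Definition ker_incl : nat_trans ker_functor F.
Proof.
exact: (@NatTrans _ _ ker_functor F (fun i => @ker_val _ _ (e i))).
Defined.

End KernelFunctor.

Section FreeCover.
Variable F : functor C.

Definition elt_below (j : C) : choiceType :=
  {u : {i : C & F i} | (tag u <= j)%O}.

Definition elt_shift i j (h : (i <= j)%O) (u : elt_below i) : elt_below j :=
  exist _ (val u) (le_trans (valP u) h).

Definition cover_map i j (h : (i <= j)%O) :
    {additive {freeg (elt_below i)} -> {freeg (elt_below j)}} :=
  free_ext (fun u => << elt_shift h u >>).

Definition cover : functor C.
Proof.
apply: (@Functor _ C (fun j => {freeg (elt_below j)}) cover_map).
  move=> i h; apply: (free_additive_eq (g := idfun)) => u.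
  by rewrite [LHS]free_extE; congr << _ >>; exact: val_inj.
move=> i j k ij jk ik.
apply: (free_additive_eq (f := cover_map jk \o cover_map ij)) => u.
by rewrite /= !free_extE; congr << _ >>; exact: val_inj.
Defined.

Definition cover_aug_comp j : {additive {freeg (elt_below j)} -> F j} :=
  free_ext (fun u : elt_below j => fmap F (valP u) (tagged (val u))).

Definition cover_aug : nat_trans cover F.
Proof.
apply: (@NatTrans _ _ cover F cover_aug_comp) => i j h.
apply: (free_additive_eq (f := cover_aug_comp j \o cover_map h)
  (g := fmap F h \o cover_aug_comp i)) => u.
rewrite /= !free_extE.
exact/esym/(fmap_comp (valP u) h (valP (elt_shift h u))).
Defined.

Lemma cover_aug_epi : epi cover_aug.
Proof.
apply: surj_epi => i y.
exists << (exist _ (Tagged (fob F) y) (lexx i) : elt_below i) >>.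
by rewrite [LHS]free_extE fmap_id.
Qed.

Lemma cover_projective : projective cover.
Proof.
move=> G H e /epi_surj es g.
pose gen (u : {i : C & F i}) : cover (tag u) :=
  << (exist _ u (lexx (tag u)) : elt_below (tag u)) >>.
pose pre u : G (tag u) := sval (cid (es _ (g _ (gen u)))).
have preE u : e _ (pre u) = g _ (gen u) by rewrite /pre; case: cid.
pose l j : {additive {freeg (elt_below j)} -> G j} :=
  free_ext (fun u : elt_below j => fmap G (valP u) (pre (val u))).
have l_nat i j (h : (i <= j)%O) x : l j (fmap cover h x) = fmap G h (l i x).
  move: x; apply: (free_additive_eq (f := l j \o cover_map h)
    (g := fmap G h \o l i)) => u.
  rewrite /= !free_extE.
exact/esym/(fmap_comp (valP u) h (valP (elt_shift h u))).
exists (@NatTrans _ _ cover G l l_nat) => i x /=.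
move: x; apply: (free_additive_eq (f := e i \o l i) (g := g i)) => u.
rewrite /= free_extE ntc_nat preE -ntc_nat; congr (g i _).
by rewrite [LHS]free_extE; congr << _ >>; exact: val_inj.
Qed.

End FreeCover.

Definition nat_comp F G H (s : nat_trans G H) (t : nat_trans F G) :
  nat_trans F H.
Proof.
apply: (@NatTrans _ _ F H (fun i => s i \o t i)) => i j h x.
by rewrite /= !ntc_nat.
Defined.

Fixpoint syzygy F (n : nat) : functor C :=
  if n is m.+1 then ker_functor (cover_aug (syzygy F m)) else F.

Definition free_res_d F n :
    nat_trans (cover (syzygy F n.+1)) (cover (syzygy F n)) :=
  nat_comp (ker_incl (cover_aug (syzygy F n))) (cover_aug (syzygy F n.+1)).

Lemma free_res_exact F n (H : functor C) (s : nat_trans (syzygy F n) H) :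
  (forall i, injective (s i)) ->
  exact (free_res_d F n) (nat_comp s (cover_aug (syzygy F n))).
Proof.
move=> s_inj i y; split=> [/= y0|[x <-]].
  have yK : y \in ker_pred (cover_aug (syzygy F n) i).
    by rewrite inE; apply/eqP/(s_inj i); rewrite y0 raddf0.
  have [x xE] := epi_surj (@cover_aug_epi (syzygy F n.+1)) (Ker yK : syzygy F n.+1 i).
  by exists x; rewrite /= xE.
by rewrite /= (kerP (f := cover_aug (syzygy F n) i)) raddf0.
Qed.

Definition nat_id F : nat_trans F F :=
  @NatTrans _ _ F F (fun i => idfun) (fun _ _ _ _ => erefl).

Definition free_resolution F : proj_resolution F.
Proof.
apply: (@ProjResolution _ _ F (fun n => cover (syzygy F n)) (free_res_d F)
  (cover_aug F)).
- by move=> n; exact: cover_projective.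
- exact: cover_aug_epi.
- by apply: (@free_res_exact F 0%N F (nat_id F)) => i x y.
- move=> n; apply: (@free_res_exact F n.+1 _ (ker_incl _)) => i.
  exact: val_inj.
Defined.

Lemma proj_resolution_exists F : inhabited (proj_resolution F).
Proof. by split; exact: free_resolution. Qed.

End Existence.

(* Main.v *)
(* Let ... -> P_1 -> P_0 -> F -> 0 be the given resolution.  The image of each of
   its maps is again pseudo-projective, and even "at infinity": if a sum of
   classes of elements x_i of the image at distinct objects i vanishes in the
   colimit, then the x_i of maximal degree lie in the image functor's Im.  For
   P_0 -> F this is the hypothesis on F, terms of lower degree being first pushed
   up to the maximal degree.  It passes from G -> H to G' -> G, for G' -> G -> H
   exact and G projective: a projective functor is a retract of a sum of functors
   induced from one object, which gives x_i in Im_G(i), and Im_G(i) meets the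
   kernel of G -> H in the image of Im_G'(i).  A cycle of colim P_n is then
   reduced, modulo boundaries, to terms of smaller and smaller degree, and
   vanishes since degrees are bounded below. *)
Require Import Defs.
From mathcomp Require Import all_boot all_order all_algebra.
From mathcomp Require Import generic_quotient ring_quotient zify.
From mathcomp Require Import boolp freeg.

Set Implicit Arguments.
Unset Strict Implicit.
Unset Printing Implicit Defensive.

Import Order.TTheory GRing.Theory Num.Theory.
Local Open Scope ring_scope.
Local Open Scope quotient_scope.

(** * Generated subgroups *)

Section Generated.
Variables (A : zmodType) (S : A -> Prop).

Lemma generatedD x y : generated S x -> generated S y -> generated S (x + y).
Proof.
move=> gx gy; rewrite -[y]opprK -[- y]sub0r.
by apply: generatedB => //; apply: generatedB => //; exact: generated0.
Qed.

Lemma generatedMz x (n : int) : generated S x -> generated S (x *~ n).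
Proof.
move=> gx; have gxn k : generated S (x *+ k).
  elim: k => [|k IH]; first exact: generated0.
  by rewrite mulrS; exact: generatedD.
case: n => k; first exact: gxn.
rewrite NegzE mulrNz -[- _]sub0r.
by apply: generatedB; [exact: generated0 | exact: gxn].
Qed.

Lemma generated_sum (I : eqType) (s : seq I) (x : I -> A) :
  (forall i, i \in s -> generated S (x i)) -> generated S (\sum_(i <- s) x i).
Proof.
move=> xS; rewrite big_seq; elim/big_ind: _ => //; first exact: generated0.
exact: generatedD.
Qed.

Lemma generated_map (B : zmodType) (T : B -> Prop) (f : {additive A -> B}) x :
  (forall y, S y -> generated T (f y)) -> generated S x -> generated T (f x).
Proof.
move=> fS; elim=> [|y z _ gy _ gz|y /fS //].
  by rewrite raddf0; exact: generated0.
by rewrite raddfB; exact: generatedB.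
Qed.

End Generated.

(** * Sums with one term per index *)

Section CollectTerms.
Variables (I : eqType) (V : I -> zmodType) (A : zmodType).
Variable c : forall i, {additive V i -> A}.

Lemma sum_widen (s t : seq I) (v : forall i, V i) :
  uniq s -> uniq t -> {subset s <= t} -> (forall i, i \notin s -> v i = 0) ->
  \sum_(i <- s) c i (v i) = \sum_(i <- t) c i (v i).
Proof.
move=> us ut st v0; rewrite [RHS](bigID (mem s)) /=.
rewrite [X in _ + X]big1 ?addr0 => [|i /v0 ->]; last exact: raddf0.
rewrite -[RHS]big_filter; apply/perm_big/uniq_perm; rewrite ?filter_uniq // => i.
by rewrite mem_filter; case: (boolP (i \in s)) => // /st.
Qed.

(** Terms with equal index merge because [c i] is additive and [R i] is a subgroup; families vanish
    off their lists so that two lists can be widened to their union. *)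
Lemma collect_terms (D : I -> Prop) (R : forall i, V i -> Prop) z :
  (forall i, R i 0) -> (forall i x y, R i x -> R i y -> R i (x - y)) ->
  generated (fun z => exists i (x : V i), [/\ D i, R i x & z = c i x]) z ->
  exists (s : seq I) (v : forall i, V i),
    [/\ uniq s, forall i, i \in s -> D i, forall i, R i (v i),
        forall i, i \notin s -> v i = 0 & z = \sum_(i <- s) c i (v i)].
Proof.
move=> R0 RB; elim=> {z} [|z1 z2 _ [s1 [v1 [u1 D1 R1 v10 ->]]]
    _ [s2 [v2 [u2 D2 R2 v20 ->]]]|z [i [x [Di Rx ->]]]].
- by exists [::], (fun j => 0 : V j); split=> //; rewrite big_nil.
- pose s := undup (s1 ++ s2).
  have in_s i : (i \in s) = (i \in s1) || (i \in s2) by rewrite mem_undup mem_cat.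
  exists s, (fun i => v1 i - v2 i); split.
  + exact: undup_uniq.
  + by move=> i; rewrite in_s => /orP[/D1|/D2].
  + by move=> i; exact: RB.
  + by move=> i; rewrite in_s => /norP[/v10 -> /v20 ->]; rewrite subr0.
  + rewrite (sum_widen (t := s) u1) ?undup_uniq //; last first.
      by move=> i; rewrite in_s => ->.
    rewrite (sum_widen (t := s) u2) ?undup_uniq //; last first.
      by move=> i; rewrite in_s => ->; rewrite orbT.
    by rewrite -sumrB; apply: eq_bigr => i _; rewrite raddfB.
- exists [:: i], (dfwith (fun j => 0 : V j) x); split=> //.
  + by move=> j; rewrite inE => /eqP ->.
  + by move=> j; case: dfwithP.
  + by move=> j; rewrite inE eq_sym => ij; rewrite dfwith_out.
  + by rewrite big_seq1 dfwith_in.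
Qed.

End CollectTerms.

(** * Transition maps, the subgroups Im, and projectives as retracts of free covers *)

Section Poset.
Context {disp : Order.disp_t} {C : porderType disp}.
Implicit Types (F G H : functor C) (i j k : C).

(* [fmap F] made total: it is 0 when there is no arrow from i to j. *)
Definition push F i j : {additive F i -> F j} :=
  match boolP (i <= j)%O with
  | AltTrue h => fmap F h
  | AltFalse _ => \0
  end.

Lemma pushE F i j (h : (i <= j)%O) x : push F i j x = fmap F h x.
Proof.
rewrite /push; case: {-}_ / boolP => [h'|/negP//].
by congr (fmap F _ x); exact: bool_irrelevance.
Qed.

Lemma push_comp F i j k (ij : (i <= j)%O) x :
  (j <= k)%O -> push F j k (fmap F ij x) = push F i k x.
Proof.
move=> jk; rewrite (pushE jk) (pushE (le_trans ij jk)).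
exact: fmap_comp.
Qed.

Lemma push_nat F G (t : nat_trans F G) i j x :
  t j (push F i j x) = push G i j (t i x).
Proof.
by rewrite /push; case: {-}_ / boolP => [h'|_]; rewrite ?ntc_nat //= raddf0.
Qed.

Lemma colim_in_push F i j x :
  (i <= j)%O -> colim_in (push F i j x) = colim_in x.
Proof. by move=> ij; rewrite (pushE ij) colim_in_nat. Qed.

Lemma generated_colim_in F (z : colim F) :
  generated (fun z => exists i (x : F i), True /\ z = colim_in x) z.
Proof.
have [x <-] := quot_pi_surj z.
elim/freeg_ind_dom0: x => [|n u D _ _ IH].
  by rewrite raddf0; exact: generated0.
rewrite raddfD; apply: generatedD => //.
have -> : << n *g u >> = << u >> *~ n :> {freeg {i : C & F i}}.
  by rewrite freegU_mulz intz.
rewrite raddfMz; apply/generatedMz/generated_in.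
by exists (tag u), (tagged u); case: u.
Qed.

(** A generated subgroup in place of the indexed sums of [in_Im], so that membership can be used by
    induction. *)
Definition Im F i : F i -> Prop := generated (fun x =>
  exists j (h : (j < i)%O) (y : F j), x = fmap F (ltW h) y).

Lemma in_Im_Im F i (x : F i) : in_Im x -> Im x.
Proof.
case=> n [a [h [y ->]]]; apply: generated_sum => k _.
by apply: generated_in; exists (a k), (h k), (y k).
Qed.

Lemma Im_nat F G (t : nat_trans F G) i (x : F i) : Im x -> Im (t i x).
Proof.
apply: generated_map => {}x [j [h [y ->]]]; apply: generated_in.
by exists j, h, (t j y); rewrite ntc_nat.
Qed.

Lemma Im_lift F G (t : nat_trans F G) i (y : G i) :
  epi t -> Im y -> exists x, Im x /\ t i x = y.
Proof.
move=> /epi_surj ts; elim=> {y} [|y1 y2 _ [x1 [I1 <-]] _ [x2 [I2 <-]]|y].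
- by exists 0; split; [exact: generated0 | rewrite raddf0].
- by exists (x1 - x2); split; [exact: generatedB | rewrite raddfB].
- case=> j [h [y' ->]]; have [x <-] := ts j y'.
  exists (fmap F (ltW h) x); split; last exact: ntc_nat.
  by apply: generated_in; exists j, h, x.
Qed.

(* A projective functor is, up to a retraction, a sum of functors induced from
   one object; [r] is the projection onto the part induced from i. *)
Definition split_at F i (r : forall j, {additive F j -> F i}) : Prop :=
  [/\ forall j k (h : (j <= k)%O) x, r k (fmap F h x) = r j x,
      forall j x, ~~ (i <= j)%O -> r j x = 0 &
      forall x : F i, Im (x - r i x)].

(** The map [r] keeps the basis elements with tag [i] and kills the others; at [i], those killed
    come from tags strictly below [i], hence lie in Im. *)
Lemma cover_split F i : exists r, split_at (F := Defs.cover F) (i := i) r.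
Proof.
pose r0 (u : {i : C & F i}) : Defs.cover F i :=
  if tag u == i then
    (* The inner 0 is a mere default: [tag u = i] makes [insub] succeed. *)
    if insub u : option (elt_below F i) is Some u' then << u' >> else 0
  else 0.
pose r j : {additive Defs.cover F j -> Defs.cover F i} :=
  free_ext (fun u : elt_below F j => r0 (val u)).
exists r; split.
- move=> j k h.
  apply: (free_additive_eq (f := r k \o fmap (Defs.cover F) h) (g := r j)) => u.
  by rewrite /= !free_extE.
- move=> j + nij; apply: (free_additive_eq (f := r j) (g := \0)) => u.
  rewrite /= free_extE /r0; case: eqP => // ui; case/negP: nij.
  by rewrite -ui; exact: (valP u).
- elim/freeg_ind_dom0 => [|n u D _ _ IH].
    by rewrite raddf0 subr0; exact: generated0.
  rewrite raddfD opprD addrACA; apply: generatedD => // {IH D}.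
  have -> : << n *g u >> = << u >> *~ n :> {freeg (elt_below F i)}.
    by rewrite freegU_mulz intz.
  rewrite raddfMz -mulrzBl.
  have gen : Im (<< u >> - r i << u >> : Defs.cover F i).
    rewrite [X in _ - X]free_extE /r0; case: eqP => [ui|/eqP ui].
      rewrite [insub _](valK u : _ = Some u) subrr; exact: generated0.
    have lt : (tag (val u) < i)%O by rewrite lt_neqAle ui (valP u).
    rewrite subr0; apply: generated_in; exists (tag (val u)), lt.
    exists << (exist _ (val u) (lexx _) : elt_below F _) >>.
    by rewrite [RHS]free_extE; congr << _ >>; exact: val_inj.
  exact: generatedMz.
Qed.

(** Lifting the identity of [F] through its free cover gives a section [l], which transports the
    splitting of the cover to [F]. *)
Lemma projective_split F i :
  projective F -> exists r, split_at (F := F) (i := i) r.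
Proof.
move=> /(_ _ _ _ (@cover_aug_epi _ _ F) (nat_id F)) [l lK].
have [r [r_nat r0 rI]] := cover_split F i.
exists (fun j => cover_aug F i \o r j \o l j); split=> [j k h x|j x nij|x] /=.
- by rewrite ntc_nat r_nat.
- by rewrite r0 ?raddf0.
- rewrite -[X in X - _](lK i x : _ = x) -raddfB; apply: Im_nat; exact: rI.
Qed.


(** * Degree arguments and pseudo-projective images *)

Section Degree.
Variable deg : C -> int.
Hypothesis deg_inc : increasing_degree deg.

(** Induction on the degree gap: unless [i] precedes [k], cut at an object strictly between them and
    keep the half whose degrees enclose [n]. *)
Lemma between_degree i k (n : int) :
  (i <= k)%O -> deg i <= n -> n <= deg k ->
  exists j, [/\ (i <= j)%O, (j <= k)%O & deg j = n].
Proof.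
have [degS degP] := deg_inc.
have [m] := ubnP `|deg k - deg i|%N.
elim: m i k => // m IH i k mP ik ni nk.
have [ein|/eqP ein] := eqVneq (deg i) n; first by exists i.
have ltik : (i < k)%O.
  by rewrite lt_neqAle ik andbT; apply/eqP => eik; move: nk; rewrite -eik; lia.
case: (pselect (precedes i k)) => [pr|npr].
  by exists k; split=> //; have := degP _ _ pr; lia.
have [r [ir rk]] : exists r, (i < r)%O /\ (r < k)%O.
  apply: contrapT => nex; apply: npr; split=> // r ir rk.
  have [->|ri] := eqVneq r i; first by left.
  have [->|rk'] := eqVneq r k; first by right.
  by case: nex; exists r; rewrite !lt_neqAle eq_sym ri ir rk' rk.
have dir := degS _ _ ir; have drk := degS _ _ rk.
have [nr|rn] := leP n (deg r).
  have [||||j [ij jr jn]] := IH i r; rewrite ?(ltW ir) //; first by lia.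
  by exists j; split=> //; exact: le_trans (ltW rk).
have [||||j [rj jk jn]] := IH r k; rewrite ?(ltW rk) ?(ltW rn) //; first by lia.
by exists j; split=> //; exact: le_trans (ltW ir) _.
Qed.

(* The image of f is pseudo-projective, in a form which allows objects of
   mixed degrees but only controls those of maximal degree. *)
Definition im_pp G H (f : nat_trans G H) : Prop :=
  forall k (s : seq C) (v : forall i, G i) i,
    uniq s -> (forall j, j \in s -> (j <= k)%O) ->
    \sum_(j <- s) f k (push G j k (v j)) = 0 ->
    i \in s -> (forall j, j \in s -> deg j <= deg i) ->
    exists y, Im y /\ f i (v i) = f i y.

(** Here the colimit of [H] replaces the value of [H] at a common upper bound [k]. *)
Definition colim_im_pp G H (f : nat_trans G H) : Prop :=
  forall (s : seq C) (v : forall i, G i) i,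
    uniq s -> \sum_(j <- s) colim_in (f j (v j)) = 0 ->
    i \in s -> (forall j, j \in s -> deg j <= deg i) ->
    exists y, Im y /\ f i (v i) = f i y.

Lemma colim_im_pp_im_pp G H (f : nat_trans G H) : colim_im_pp f -> im_pp f.
Proof.
move=> fP k s v i us sk s0; apply: fP => //.
have := congr1 (@colim_in _ _ H k) s0.
rewrite raddf_sum raddf0 => ck0; rewrite -[RHS]ck0 big_seq [RHS]big_seq.
by apply: eq_bigr => j /sk jk; rewrite push_nat [RHS]colim_in_push.
Qed.

Lemma pseudo_projective_seq F k (n : int) (s : seq C) (v : forall i, F i) :
  pseudo_projective deg F -> uniq s ->
  (forall j, j \in s -> (j <= k)%O /\ deg j = n) ->
  \sum_(j <- s) push F j k (v j) = 0 -> forall j, j \in s -> Im (v j).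
Proof.
move=> Fpp us sP s0 j js; pose a := tnth (in_tuple s).
have aP l : (a l <= k)%O /\ deg (a l) = n by apply/sP/mem_tnth.
have /tnthP[l ->] : j \in in_tuple s by [].
apply: in_Im_Im.
apply: (Fpp `|deg k - n|%N k _ a (fun l => (aP l).1) (fun l => v (a l))).
- exact/tuple_uniqP.
- by move=> l'; rewrite /arrow_deg (aP l').2.
- rewrite -[RHS]s0 [RHS]big_tnth; apply: eq_bigr => l' _.
  by rewrite [RHS](pushE (aP l').1).
Qed.

Lemma pseudo_projective_im_pp G F (f : nat_trans G F) :
  pseudo_projective deg F -> epi f -> im_pp f.
Proof.
move=> Fpp fepi k s v i us sk + is_ top.
under eq_bigr do rewrite push_nat.
set w : forall j, F j := fun j => f j (v j).
rewrite -[LHS]/(\sum_(j <- s) push F j k (w j)) (bigD1_seq i) //=.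
set Z := (X in _ + X) => Z0.
suff : Im (w i) by case/(Im_lift fepi) => y [Iy yE]; exists y.
(* Terms of degree below [deg i] are pushed up to that degree, where they lie in Im; this is
   recorded only at [i], where a pushed term may land. *)
have : generated (fun z => exists j (x : F j),
    [/\ (j <= k)%O /\ deg j = deg i, j = i -> Im x & z = push F j k x]) Z.
  rewrite /Z -big_filter; apply: generated_sum => j.
  rewrite mem_filter => /andP[/eqP ji js]; apply: generated_in.
  have [eij|/eqP nij] := eqVneq (deg j) (deg i).
    by exists j, (w j); split=> //; split=> //; exact: sk.
  have ltji : deg j < deg i by have := top _ js; lia.
  have [|||j' [jj' j'k dj']] := @between_degree j k (deg i).
  - exact: sk.
  - exact: ltW.
  - have := sk _ is_; rewrite le_eqVlt => /orP[/eqP -> //|].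
    by move=> /(proj1 deg_inc)/ltW.
  have lt : (j < j')%O.
    by rewrite lt_neqAle jj' andbT; apply: contraTneq ltji => ->; rewrite dj' ltxx.
  exists j', (push F j j' (w j)); split=> // [_|].
    by apply: generated_in; exists j, lt, (w j); exact: pushE.
  by rewrite (pushE jj') push_comp.
case/collect_terms => [j _|j x y Rx Ry /[dup]/Rx Ix /Ry Iy|].
- exact: generated0.
- exact: generatedB.
move=> t [u [ut tP uI u0 ZE]].
(* The list [t] may miss [i]. Joining [w i] to the collected terms gives a relation in a single
   degree; since [u i] lies in Im, so does [w i] once [w i + u i] does. *)
pose t' := undup (i :: t).
pose w' : forall j, F j := dfwith (fun j => 0 : F j) (w i).
have it' : i \in t' by rewrite mem_undup mem_head.
suff /(_ i it') : forall j, j \in t' -> Im (w' j + u j).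
  rewrite /w' dfwith_in => wu; rewrite -[w i](addrK (u i)).
  by apply: generatedB => //; exact: uI.
apply: (pseudo_projective_seq (k := k) (n := deg i)) => //.
- exact: undup_uniq.
- by move=> j; rewrite mem_undup inE => /orP[/eqP -> |/tP //]; split=> //; exact: sk.
rewrite -[RHS]Z0 ZE.
rewrite (sum_widen (fun j => push F j k) (t := t') ut) ?undup_uniq //; last first.
  by move=> j jt; rewrite mem_undup inE jt orbT.
have -> : push F i k (w i) = \sum_(j <- t') push F j k (w' j).
  rewrite -(@sum_widen _ _ _ (fun j => push F j k) [:: i]) ?undup_uniq //.
  - by rewrite big_seq1 /w' dfwith_in.
  - by move=> j; rewrite inE => /eqP ->.
  - by move=> j; rewrite inE eq_sym => ij; rewrite /w' dfwith_out.
by rewrite -big_split; apply: eq_bigr => j _; rewrite raddfD.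
Qed.

(** * Removing terms of maximal degree along an exact sequence *)

Section Peel.
Hypothesis deg_bnd : deg_bounded_below deg.
Variables (G' G H : functor C) (e : nat_trans G' G) (f : nat_trans G H).
Hypothesis ef : exact e f.

Lemma exact_comp i w : f i (e i w) = 0.
Proof. by apply/ef; exists w. Qed.

(* Descending induction on a bound for the degrees occurring in z: modulo Im e,
   the terms of maximal degree can be replaced by terms of lower degree. *)
Lemma peel (A B : zmodType) (c : forall i, {additive G i -> A})
    (phi : {additive A -> B}) (D : C -> Prop) z :
  (forall j i, (j < i)%O -> D i -> D j) ->
  (forall j i (h : (j <= i)%O) x, D i -> c i (fmap G h x) = c j x) ->
  (forall i w, D i -> phi (c i (e i w)) = 0) ->
  (forall (s : seq C) (v : forall i, G i) i, uniq s ->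
    (forall j, j \in s -> D j) -> \sum_(j <- s) phi (c j (v j)) = 0 ->
    i \in s -> (forall j, j \in s -> deg j <= deg i) ->
    exists y, Im y /\ f i (v i) = f i y) ->
  generated (fun z => exists i (x : G i), D i /\ z = c i x) z -> phi z = 0 ->
  generated (fun z => exists i (w : G' i), D i /\ z = c i (e i w)) z.
Proof.
move=> D_down c_nat phi_e top gz.
have [m mP] := deg_bnd.
(* All degrees are at least [m], so [gen 0] contains only 0 and the induction on [n] starts
   there. *)
pose gen n := generated (fun z => exists i (x : G i),
  [/\ D i /\ deg i < m + Posz n, True & z = c i x]).
have [n] : exists n, gen n z.
  elim: gz => {z} [|x y _ [n1 g1] _ [n2 g2]|z [i [x [Di ->]]]].
  - by exists 0%N; exact: generated0.
  - exists (maxn n1 n2); apply: generatedB.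
    + apply: (generated_map (f := idfun)) g1 => z [i [t [[Di di] _ ->]]].
      by apply: generated_in; exists i, t; split=> //; split=> //; lia.
    + apply: (generated_map (f := idfun)) g2 => z [i [t [[Di di] _ ->]]].
      by apply: generated_in; exists i, t; split=> //; split=> //; lia.
  - exists (`|deg i - m|.+1)%N; apply: generated_in.
    by exists i, x; split=> //; split=> //; have := mP i; lia.
elim: n z {gz} => [|n IH] z.
  case/(collect_terms (R := fun _ _ => True)) => // -[|i s] [v [_ sP _ _ ->]] _.
    by rewrite big_nil; exact: generated0.
  by have [_] := sP i (mem_head _ _); have := mP i; lia.
case/(collect_terms (R := fun _ _ => True)) => // s [v [us sP _ _ ->]].
rewrite raddf_sum => s0.
(* A term of degree below [m + n] stays as it is. One of degree [m + n] is maximal, so modulo the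
   image of [e] it is an element of Im, which comes from smaller degrees. *)
have peel1 i : exists w, i \in s -> gen n (c i (v i - e i w)).
  case: (boolP (i \in s)) => [is_|]; last by exists 0.
  have [Di di] := sP _ is_.
  case: (ltP (deg i) (m + n%:Z)) => [lt|ge].
    by exists 0 => _; apply: generated_in; exists i, (v i - e i 0).
  have [|||||y [Iy]] := top s v i => //.
  - by move=> j /sP[].
  - by move=> j /sP[_ dj]; lia.
  move=> vy; have : f i (v i - y) = 0 by rewrite raddfB vy subrr.
  case/ef => w wE; exists w => _; rewrite wE opprB addrC subrK.
  apply: generated_map Iy => _ [j [h [x ->]]]; rewrite c_nat //.
  apply: generated_in; exists j, x; split=> //; split; first exact: D_down Di.
  by have := proj1 deg_inc _ _ h; lia.
pose w i := projT1 (cid (peel1 i)).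
have wP i : i \in s -> gen n (c i (v i - e i (w i))) by rewrite /w; case: cid.
rewrite (eq_bigr (fun i => c i (v i - e i (w i)) + c i (e i (w i)))); last first.
  by move=> i _; rewrite -raddfD subrK.
rewrite big_split; apply: generatedD; last first.
  apply: generated_sum => i is_; apply: generated_in.
  by exists i, (w i); split=> //; case: (sP _ is_).
apply: IH; first exact: generated_sum.
rewrite raddf_sum -[RHS]s0 big_seq [RHS]big_seq; apply: eq_bigr => i is_.
by rewrite !raddfB phi_e ?subr0 //; case: (sP _ is_).
Qed.

(** Peeling inside [G i], over the objects below [i], turns [x] into a sum of pushed elements
    [e j w]; pushing each [w] in [G'] instead gives the preimage. *)
Lemma Im_strict i (x : G i) :
  im_pp f -> Im x -> f i x = 0 -> exists y, Im y /\ e i y = x.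
Proof.
move=> fP Ix fx.
have : generated (fun z => exists j (w : G' j),
    (j < i)%O /\ z = push G j i (e j w)) x.
  apply: (peel (phi := f i)) fx.
  - by move=> j k; exact: lt_trans.
  - by move=> j k h y /ltW; exact: push_comp.
  - by move=> j w _; rewrite push_nat exact_comp raddf0.
  - move=> s v j us sP; apply: fP => // l /sP; exact: ltW.
  - apply: (generated_map (f := idfun)) Ix => y [j [h [t ->]]].
    by apply: generated_in; exists j, t; split=> //; rewrite (pushE (ltW h)).
elim=> [|_ _ _ [y1 [I1 <-]] _ [y2 [I2 <-]]|_ [j [w [h ->]]]].
- by exists 0; split; [exact: generated0 | rewrite raddf0].
- by exists (y1 - y2); split; [exact: generatedB | rewrite raddfB].
- exists (fmap G' (ltW h) w); split; first by apply: generated_in; exists j, h, w.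
  by rewrite ntc_nat (pushE (ltW h)).
Qed.

Lemma im_pp_syzygy : projective G -> im_pp f -> colim_im_pp e.
Proof.
move=> Gproj fP s v i us s0 is_ top.
have [r [r_nat r0 rI]] := projective_split i Gproj.
(* The maps [r j] factor through the colimit; a term at [j] other than [i] could survive only if
   [i < j], which the maximality of [deg i] excludes. *)
have ri : r i (e i (v i)) = 0.
  have := congr1 (colim_desc r_nat) s0; rewrite raddf_sum raddf0.
  rewrite (eq_bigr (fun j => r j (e j (v j)))) => [|j _]; last exact: colim_descE.
  rewrite (bigD1_seq i) //= big_seq_cond big1 ?addr0 // => j.
  case/andP=> js ji; rewrite r0 //; apply/negP => ij.
  have /(proj1 deg_inc) : (i < j)%O by rewrite lt_neqAle eq_sym ji ij.
  by rewrite ltNge top.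
have := rI (e i (v i)); rewrite ri subr0 => Ie.
have [y [Iy yE]] := Im_strict fP Ie (exact_comp _).
by exists y.
Qed.

(** Peeling in the colimit of [G] leaves a sum of classes of elements [e i w], each the image of the
    class of [w]. *)
Lemma colim_exact (z : colim G) :
  colim_im_pp f -> colim_map f z = 0 -> exists w, colim_map e w = z.
Proof.
move=> fP fz.
have : generated (fun z => exists i (w : G' i),
    True /\ z = colim_in (e i w)) z.
  apply: (peel (c := @colim_in _ _ G) (phi := colim_map f) (D := fun=> True)) fz => //.
  - by move=> j k h y _; exact: colim_in_nat.
  - by move=> j w _; rewrite colim_mapE exact_comp raddf0.
  - move=> s v j us _ s0; apply: fP => //; rewrite -[RHS]s0.
    by apply: eq_bigr => l _; rewrite colim_mapE.
  - exact: generated_colim_in.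
elim=> [|_ _ _ [y1 <-] _ [y2 <-]|_ [i [w [_ ->]]]].
- by exists 0; rewrite raddf0.
- by exists (y1 - y2); rewrite raddfB.
- by exists (colim_in w); exact: colim_mapE.
Qed.

End Peel.

End Degree.

End Poset.

Theorem theoremB (disp : Order.disp_t) (C : porderType disp) (deg : C -> int)
    (deg_inc : increasing_degree deg) (deg_bnd : deg_bounded_below deg)
    (F : functor C) (F_pp : pseudo_projective deg F) :
  colim_acyclic F.
Proof.
move=> P [//|n] _ x.
(* Induction along the resolution, starting from the augmentation onto [F]. *)
have Ppp k : colim_im_pp deg (res_d P k).
  elim: k => [|k /colim_im_pp_im_pp IH].
    refine (im_pp_syzygy deg_inc deg_bnd (@res_exact0 _ _ _ P) _ _).
      exact: res_projective.
    by apply: pseudo_projective_im_pp F_pp _ => //; exact: res_aug_epi.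
  refine (im_pp_syzygy deg_inc deg_bnd (@res_exact _ _ _ P k) _ IH).
  exact: res_projective.
have [w wE] : exists w, colim_map (res_d P n.+1) w = ker_val (repr x).
  exact: (colim_exact deg_inc deg_bnd (@res_exact _ _ _ P n) (Ppp n) (kerP _)).
(* The class [x] vanishes because its representative is a boundary. *)
rewrite -[x]reprK -[RHS](raddf0 (\pi_(homology _ _))).
apply/eqP; rewrite -Quotient.idealrBE subr0; apply/asboolP.
by exists w.
Qed.
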